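(* For every positive integer $t$, if $G$ is a graph with minimum degree at least $11t+7$, then $G$ contains the complete graph $K_t$ as a strong immersion.
   Context: Graphs are finite, simple (no loops, no parallel edges), with non-empty vertex set. An immersion of a graph $H$ in a graph $G$ is a one-to-one mapping $\varphi:V(H)\to V(G)$ together with a collection of pairwise edge-disjoint paths in $G$, one path $P_{uv}$ for each edge $uv$ of $H$, such that $P_{uv}$ has endpoints $\varphi(u)$ and $\varphi(v)$. The immersion is strong if the paths $P_{uv}$ are internally disjoint from $\varphi(V(H))$ (no internal vertex of any $P_{uv}$ lies in $\varphi(V(H))$). ''$G$ contains $H$ as a strong immersion'' means that a strong immersion of $H$ in $G$ exists. *)

(* Defs.v *)
From mathcomp Require Import all_boot.

Set Implicit Arguments.
Unset Strict Implicit.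
Unset Printing Implicit Defensive.

Record sgraph := SGraph {
  vertex :> finType;
  adj : rel vertex;
  adj_sym : symmetric adj;
  adj_irrefl : irreflexive adj;
  vertex_nonempty : 0 < #|vertex| }.

Definition edges (G : sgraph) : {set {set G}} :=
  [set [set p.1; p.2] | p : G * G & adj p.1 p.2].

Definition degree (G : sgraph) (x : G) : nat := #|[set y | adj x y]|.

(* Every degree is less than #|G| and G has a vertex, so the default value
   #|G| never contributes to the minimum. *)
Definition min_degree (G : sgraph) : nat :=
  \big[minn/#|G|]_(x : G) degree x.

Section CompleteGraph.
Variables (n : nat) (n_gt0 : 0 < n).

Definition complete_adj : rel 'I_n := fun i j => i != j.

Lemma complete_adj_sym : symmetric complete_adj.
Proof. by move=> i j; rewrite /complete_adj eq_sym. Qed.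

Lemma complete_adj_irrefl : irreflexive complete_adj.
Proof. by move=> i; rewrite /complete_adj eqxx. Qed.

Lemma complete_nonempty : 0 < #|'I_n|.
Proof. by rewrite card_ord. Qed.

Definition complete_graph : sgraph :=
  SGraph complete_adj_sym complete_adj_irrefl complete_nonempty.

End CompleteGraph.

(* A path is given by the sequence of all its vertices, both ends included;
   no vertex is repeated. *)
Definition path_between (G : sgraph) (x y : G) (s : seq G) : bool :=
  if s is z :: p then
    [&& z == x, path (@adj G) z p, last z p == y & uniq (z :: p)]
  else false.

Definition path_edges (G : sgraph) (s : seq G) : seq {set G} :=
  [seq [set p.1; p.2] | p <- zip s (behead s)].

Definition internal_vertices (G : sgraph) (s : seq G) : seq G :=
  if s is z :: p then behead (belast z p) else [::].

(* P is indexed by subsets of V(H), but only its values on the edges of H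
   matter. The path of an unordered edge may be listed from either end. *)
Definition is_immersion (H G : sgraph) (phi : H -> G)
    (P : {set H} -> seq G) : Prop :=
  [/\ injective phi,
      forall u v : H, adj u v ->
        path_between (phi u) (phi v) (P [set u; v]) \/
        path_between (phi v) (phi u) (P [set u; v])
    & forall e f : {set H}, e \in edges H -> f \in edges H -> e != f ->
        forall d : {set G}, d \in path_edges (P e) -> d \notin path_edges (P f)].

Definition is_strong_immersion (H G : sgraph) (phi : H -> G)
    (P : {set H} -> seq G) : Prop :=
  is_immersion phi P /\
  (forall (e : {set H}) (w : H), e \in edges H ->
     phi w \notin internal_vertices (P e)).

Definition contains_strong_immersion (G H : sgraph) : Prop :=
  exists (phi : H -> G) (P : {set H} -> seq G), is_strong_immersion phi P.

(* Main.v *)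
Require Import Defs.
From mathcomp Require Import all_boot.
From mathcomp Require Import zify.

(* Let G be a graph all of whose degrees are at least d + 1, where
   d = 11t + 6, except for one vertex v of degree at least d. Splitting off v,
   that is, deleting v and joining its neighbours in pairs by new edges,
   preserves the other degrees as long as the complement of G[N(v)] has a
   perfect matching; a near-perfect matching only creates one new vertex of
   degree d. Otherwise the Tutte-Berge formula gives a set S whose removal from
   N(v) leaves more than |S| + 1 parts that are pairwise completely joined.
   Either these parts contain a biclique K_{t,2t}, hence an immersion of K_t,
   or all but one of them form a set R with |S| < |R| < t, complete to the rest
   of N(v) \ S. In that case R joins v in a cluster A of vertices that are to be
   split off one after the other. All of A is complete to a set W that loses
   fewer than 2|R| elements when A grows by R and at most one element when a
   vertex is split off. A vertex x left unmatched at a in A is matched to a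
   non-neighbour y of x with y in N(p), where p is a neighbour of a in A, along
   the path x a p y; if there is no such y, then x is complete to W and joins
   the cluster. If the cluster ever reaches t vertices, then any two of them
   have at least 2t common neighbours in W in the graph from which the cluster
   was started, and K_t is immersed greedily with these t vertices as branch
   vertices. Otherwise the cluster is used up and a smaller graph of the same
   kind remains, which cannot go on forever. *)

Set Implicit Arguments.
Unset Strict Implicit.
Unset Printing Implicit Defensive.

(** * Immersions of edge sets *)

Lemma eqset2 (T : finType) (a b c d : T) :
  ([set a; b] == [set c; d]) = (a == c) && (b == d) || (a == d) && (b == c).
Proof.
apply/eqP/orP => [e|[]/andP[/eqP-> /eqP->] //]; last by rewrite setUC.
have : a \in [set c; d] by rewrite -e set21.
have : b \in [set c; d] by rewrite -e set22.
have : d \in [set a; b] by rewrite e set22.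
have : c \in [set a; b] by rewrite e set21.
rewrite !inE !(eq_sym c) !(eq_sym d).
by do 4![case/orP => /eqP?]; subst; rewrite !eqxx; auto.
Qed.

Lemma set2_inj (T : finType) (a b c d : T) :
  [set a; b] = [set c; d] -> (a = c /\ b = d) \/ (a = d /\ b = c).
Proof.
by move/eqP; rewrite eqset2 => /orP[]/andP[/eqP-> /eqP->]; [left|right].
Qed.

Section Immersions.
Variable V : finType.
Implicit Types (E F : {set {set V}}) (Z : {set V}) (x y u w : V).

(** Walks suffice, since shortening them to paths at the end loses nothing. [s] omits the start
    [x]. *)
Definition connected_by Z F x y :=
  exists s, [/\ path (fun u w => [set u; w] \in F) x s, last x s = y
    & {in s, forall u, u \in Z -> u = x \/ u = y}].

(** Each edge of [E'] owns a set of edges of [E] instead of a path, so immersions compose by unions.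
    [Z] holds the vertices that may still become branch vertices. All graphs live on the one type
    [V]. *)
Definition immersed Z E E' :=
  exists tau : {set V} -> {set {set V}},
  [/\ {in E', forall e, tau e \subset E},
      {in E' &, forall e f, e != f -> [disjoint tau e & tau f]}
    & forall x y, [set x; y] \in E' ->
        connected_by Z (tau [set x; y]) x y].

Lemma connected_byS Z1 Z2 F1 F2 x y : Z2 \subset Z1 -> F1 \subset F2 ->
  connected_by Z1 F1 x y -> connected_by Z2 F2 x y.
Proof.
move=> sZ sF [s [ps ls hs]]; exists s; split=> //.
  by apply: sub_path ps => u w; apply: (subsetP sF).
by move=> u us uZ; apply: hs => //; apply: (subsetP sZ).
Qed.

Lemma connected_by1 Z F x y : [set x; y] \in F -> connected_by Z F x y.
Proof.
by move=> h; exists [:: y]; split=> //=; [rewrite h|move=> u /[!inE]/eqP->; right].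
Qed.

Lemma connected_by_trans Z F x y z : y \notin Z ->
  connected_by Z F x y -> connected_by Z F y z -> connected_by Z F x z.
Proof.
move=> yZ [s [ps ls hs]] [r [pr lr hr]]; exists (s ++ r); split.
- by rewrite cat_path ps ls.
- by rewrite last_cat ls.
move=> u; rewrite mem_cat => /orP[/hs h|/hr h] uZ.
  by case: (h uZ) => [->|e]; [left|rewrite e (negPf yZ) in uZ].
by case: (h uZ) => [e|->]; [rewrite e (negPf yZ) in uZ|right].
Qed.

(** Walks substituted for edges meet [Z] only at the ends of these edges, which lie on the old
    walk. *)
Lemma connected_by_path Z F F' x s :
  path (fun u w => [set u; w] \in F') x s ->
  (forall u w, [set u; w] \in F' -> connected_by Z F u w) ->
  exists s', [/\ path (fun u w => [set u; w] \in F) x s', last x s' = last x s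
    & {in s', forall u, u \in Z -> u \in x :: s}].
Proof.
move=> + h; elim: s x => [|y s IH] x /=; first by exists [::].
case/andP=> /h[r [pr lr hr]] /IH[s' [ps' ls' hs']].
exists (r ++ s'); split; first by rewrite cat_path pr lr.
  by rewrite last_cat lr.
move=> u; rewrite mem_cat => /orP[/hr|/hs'] k /k.
  by rewrite !inE; case=> ->; rewrite eqxx ?orbT.
by rewrite !inE => ->; rewrite orbT.
Qed.

Lemma immersed_refl Z E : immersed Z E E.
Proof.
exists (fun e => [set e]); split=> [e eE|e f _ _ ef|x y xyE].
- by rewrite sub1set.
- by rewrite disjoints1 inE.
- by apply: connected_by1; rewrite inE.
Qed.

Lemma immersedS Z Z' E E' E'' : Z' \subset Z -> E'' \subset E' ->
  immersed Z E E' -> immersed Z' E E''.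
Proof.
move=> sZ /subsetP sE [tau [h1 h2 h3]]; exists tau.
split=> [e /sE/h1//|e f /sE ee /sE ff|x y /sE/h3].
  exact: h2.
exact: connected_byS.
Qed.

Lemma immersed_trans Z E E' E'' :
  immersed Z E E' -> immersed Z E' E'' -> immersed Z E E''.
Proof.
move=> [tau [h1 h2 h3]] [rho [k1 k2 k3]].
exists (fun e => \bigcup_(f in rho e) tau f); split=> [e eE|e f eE fE ef|x y xyE].
- by apply/bigcupsP=> f fe; apply: h1; apply: (subsetP (k1 _ eE)).
- apply/pred0P=> g /=; apply/negP=> /andP[/bigcupP[a ar ga] /bigcupP[b br gb]].
  have [eab|ab] := eqVneq a b.
    by have/pred0P/(_ a) := k2 _ _ eE fE ef; rewrite /= ar eab br.
  have/pred0P/(_ g) := h2 _ _ (subsetP (k1 _ eE) _ ar) (subsetP (k1 _ fE) _ br) ab.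
  by rewrite /= ga gb.
- have [s [ps ls hs]] := k3 _ _ xyE.
  have [|s' [ps' ls' hs']] := @connected_by_path Z
    (\bigcup_(f in rho [set x; y]) tau f) _ _ _ ps.
    move=> u w uw; apply: connected_byS (subxx _) _ (h3 _ _ _).
      exact: (bigcup_sup [set u; w]).
    exact: (subsetP (k1 _ xyE)).
  exists s'; split; rewrite ?ls' // => u /hs' k uZ.
  by move: (k uZ); rewrite inE => /orP[/eqP->|/hs/(_ uZ)]; [left|].
Qed.

Definition pairs (B : {set V}) : {set {set V}} :=
  [set e : {set V} | e \subset B & #|e| == 2].

End Immersions.

(** * From immersions of edge sets to strong immersions of graphs *)

Lemma path_edges_sub (G : sgraph) (F : {set {set G}}) (z : G) p :
  path (fun u w => [set u; w] \in F) z p -> {subset path_edges (z :: p) <= F}.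
Proof.
rewrite /path_edges /=; elim: p z => [|y p IH] z //= /andP[zy /IH h] e.
by rewrite inE => /orP[/eqP->|/h].
Qed.

Lemma immersed_pairs_strong t (t_gt0 : 0 < t) (G : sgraph) (B : {set G}) :
  #|B| = t -> immersed B (edges G) (pairs B) ->
  contains_strong_immersion G (complete_graph t_gt0).
Proof.
move=> Bt [tau [h1 h2 h3]].
pose phi (i : 'I_t) : G := enum_val (cast_ord (esym Bt) i).
have phiB i : phi i \in B by apply: enum_valP.
have phi_inj : injective phi by move=> i j /enum_val_inj/cast_ord_inj.
have pairB i j : i != j -> [set phi i; phi j] \in pairs B.
  move=> ij; rewrite inE subUset !sub1set !phiB /= cards2.
  by rewrite (inj_eq phi_inj) ij.
have edgeE e : e \in edges (complete_graph t_gt0) ->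
    exists i j : 'I_t, i != j /\ e = [set i; j].
  by case/imsetP=> -[i j] /= ij ->; exists i, j; split=> //; move: ij; rewrite inE.
have /fin_all_exists[P hP] : forall e : {set 'I_t}, exists s : seq G,
    e \in edges (complete_graph t_gt0) ->
    [/\ exists i j, [/\ i != j, e = [set i; j] & path_between (phi i) (phi j) s],
        {subset path_edges s <= tau (phi @: e)}
      & forall w, phi w \notin internal_vertices s].
  move=> e; have [/edgeE[i [j [ij ->]]]|] := boolP (e \in _); last by exists [::].
  have [s [ps ls hs]] := h3 _ _ (pairB _ _ ij).
  (* The shortened walk repeats no vertex, so its ends, the only branch vertices on it, are not
     internal. *)
  case/shortenP: ps ls => s' ps' us' ss' ls.
  exists (phi i :: s') => _; split.
  - exists i, j; split=> //=; rewrite eqxx ls eqxx /= -/(uniq (_ :: _)) us' andbT.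
    apply: sub_path ps' => u w uw.
    have /imsetP[[a b] /=] := subsetP (h1 _ (pairB _ _ ij)) _ uw.
    rewrite inE => /= ab /esym ee.
    by case: (set2_inj ee) => -[<- <-]; rewrite // adj_sym.
  - by rewrite imsetU1 imset_set1; apply: path_edges_sub.
  - move=> w; rewrite /internal_vertices; apply/negP.
    have /andP[ni us] : (phi i \notin s') && uniq s' := us'.
    case/lastP: s' ps' us' ss' ls us ni => [|s' z] //= ps' us' ss' ls us ni.
    rewrite belast_rcons /= => ws.
    have wr : phi w \in rcons s' z by rewrite mem_rcons inE ws orbT.
    case: (hs _ (ss' _ wr) (phiB w)) => e'; first by rewrite -e' wr in ni.
    by move: us; rewrite rcons_uniq -[z](last_rcons (phi i) s') ls -e' ws.
exists phi, P; split; first split=> //.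
- move=> i j ij; have eij : [set i; j] \in edges (complete_graph t_gt0).
    by apply/imsetP; exists (i, j); rewrite ?inE.
  have [[i' [j' [_ e pb]]] _ _] := hP _ eij.
  by case: (set2_inj e) => -[? ?]; subst; [left|right].
- move=> e f eE fE ef d de; apply/negP=> df.
  have [_ /(_ _ de) he _] := hP _ eE; have [_ /(_ _ df) hf _] := hP _ fE.
  have pe k : k \in edges (complete_graph t_gt0) -> phi @: k \in pairs B.
    by case/edgeE=> i [j [ij ->]]; rewrite imsetU1 imset_set1 pairB.
  have ne : phi @: e != phi @: f by rewrite (inj_eq (imset_inj phi_inj)).
  by have/pred0P/(_ d) := h2 _ _ (pe _ eE) (pe _ fE) ne; rewrite /= he hf.
- by move=> e w /hP[].
Qed.

Lemma cardsD_lb (T : finType) (A B : {set T}) : #|A| - #|B| <= #|A :\: B|.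
Proof. by rewrite leq_subLR -(cardsID B A) leq_add2r subset_leq_card // subsetIr. Qed.

(** * Greedy immersion of complete graphs through common neighbours *)

Section Hubs.
Variable V : finType.
Implicit Types (E F : {set {set V}}) (x y u w : V).

Definition nbr E x := [set y | [set x; y] \in E].

Lemma nbr_sym E x y : (y \in nbr E x) = (x \in nbr E y).
Proof. by rewrite !inE setUC. Qed.

(** A pair [e] in [B] meets at most [2 * (#|B| - 2)] other pairs, fewer than [C e] has elements, so
    the choices can be made one by one. With option values no default vertex is needed. *)
Lemma greedy_choice (B : {set V}) (C : {set V} -> {set V}) (es : seq {set V}) :
  uniq es -> {subset es <= pairs B} -> {in es, forall e, 2 * #|B| <= #|C e|} ->
  exists c : {set V} -> option V,
    {in es, forall e, exists2 w, c e = Some w & w \in C e} /\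
    {in es &, forall e f : {set V}, e != f -> ~~ [disjoint e & f] -> c e != c f}.
Proof.
elim: es => [|e es IH] /=; first by exists (fun=> None).
case/andP=> ees ues sub big.
have [||c [c1 c2]] := IH ues.
- by move=> f fes; apply: sub; rewrite inE fes orbT.
- by move=> f fes; apply: big; rewrite inE fes orbT.
have /[!inE]/andP[eB /eqP e2] := sub e (mem_head _ _).
(* The values of [c] at all pairs sharing exactly one vertex with [e], treated already or not. *)
pose X := [set c [set p.1; p.2] | p in setX e (B :\: e)].
have : #|[set w in C e | Some w \in X]| < #|C e|.
  apply: leq_ltn_trans (_ : #|X| < _).
    rewrite -(card_imset _ (@Some_inj _ : injective (@Some V))) subset_leq_card //.
    by apply/subsetP=> _ /imsetP[w /[!inE]/andP[_ wX] ->].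
  apply: leq_ltn_trans (leq_imset_card _ _) _.
  rewrite cardsX e2 cardsDS // e2.
  have := big e (mem_head _ _); have := subset_leq_card eB; lia.
rewrite ltnNge => /negP ne.
have [w wC wX] : exists2 w : V, w \in C e & Some w \notin X.
  apply/exists_inP; apply: contra_notT ne => /exists_inPn h.
  by apply/subset_leq_card/subsetP=> w wC; rewrite inE wC; apply/negPn/h.
exists (fun f => if f == e then Some w else c f); split=> [f|].
  rewrite inE; case: eqVneq => [-> _|_ /= /c1//]; by exists w.
have sep f : f \in es -> f != e -> ~~ [disjoint e & f] -> c f != Some w.
  move=> fes fe /pred0Pn[b /andP[/= be bf]].
  have /[!inE]/andP[fB /eqP f2] : f \in pairs B by apply: sub; rewrite inE fes orbT.
  have [d ef] : exists d, f = [set b; d].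
    have /cards1P[d ed] : #|f :\ b| == 1.
      by have := cardsD1 b f; rewrite bf f2; case: #|_| => [|[]].
    by exists d; rewrite -ed setD1K.
  have df : d \in f by rewrite ef set22.
  apply: contraNneq wX => <-; apply/imsetP; exists (b, d); rewrite ?ef //=.
  rewrite inE /= be inE (subsetP fB _ df) andbT.
  apply: contra fe => de; rewrite eqEcard e2 f2 andbT ef subUset !sub1set be.
  by rewrite de.
move=> f g; rewrite !inE; case: (eqVneq f e) => [-> _|fe /= fes];
  case: (eqVneq g e) => [-> _|ge /= ges].
- by rewrite eqxx.
- by move=> _ dj; rewrite eq_sym; apply: sep.
- by move=> _ dj; apply: sep => //; rewrite disjoint_sym.
- exact: c2.
Qed.

(** Each pair is joined by a path of length two through its chosen [w]. As [w] is outside [B], an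
    edge [[set b; w]] determines [b] and [w], and pairs sharing [b] have different [w]. *)
Lemma hubs_immersed E (B : {set V}) :
  {in B &, forall b c, b != c -> 2 * #|B| <= #|(nbr E b :&: nbr E c) :\: B|} ->
  immersed B E (pairs B).
Proof.
move=> h.
pose C (e : {set V}) := (\bigcap_(b in e) nbr E b) :\: B.
have [||c [c1 c2]] := @greedy_choice B C (enum (pairs B)) (enum_uniq _).
- by move=> e; rewrite mem_enum.
- move=> e; rewrite mem_enum inE => /andP[eB /cards2P[x [y [xy ee]]]].
  have [xB yB] : x \in B /\ y \in B.
    by split; apply: (subsetP eB); rewrite ee ?set21 ?set22.
  by rewrite /C ee bigcap_setU !big_set1 h.
have cP e : e \in pairs B -> exists w, [/\ c e = Some w, w \notin B &
    {in e, forall b, [set b; w] \in E}].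
  rewrite -mem_enum => /c1[w cw]; rewrite inE => /andP[wB /bigcapP hw].
  by exists w; split=> // b /hw; rewrite inE.
exists (fun e => if c e is Some w then [set [set b; w] | b in e] else set0); split.
- move=> e /cP[w [-> _ hw]]; apply/subsetP=> _ /imsetP[b be ->]; exact: hw.
- move=> e f eB fB ef; have [w [ce wB _]] := cP _ eB; have [u [cf uB _]] := cP _ fB.
  rewrite ce cf; apply/pred0P=> d /=; apply/negP.
  case/andP=> /imsetP[b be ->] /imsetP[b' bf] eq.
  have bB : b \in B by move: eB; rewrite inE => /andP[/subsetP->].
  have b'B : b' \in B by move: fB; rewrite inE => /andP[/subsetP->].
  case: (set2_inj eq) => -[e1 e2]; last by rewrite e1 (negPf uB) in bB.
  have := c2 e f; rewrite !mem_enum ce cf e2 eqxx => /(_ eB fB ef).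
  by move=> k; have : [disjoint e & f]; [apply: contraT => /k|
    move/pred0P/(_ b); rewrite /= be e1 bf].
- move=> x y /[dup] /cP[w [-> wB _]] _.
  apply: (@connected_by_trans _ _ _ _ w) => //; apply: connected_by1.
    by apply/imsetP; exists x; rewrite ?set21.
  by rewrite setUC; apply/imsetP; exists y; rewrite ?set22.
Qed.

Lemma biclique_immersed E (X Y : {set V}) t :
  [disjoint X & Y] -> {in X & Y, forall x y, [set x; y] \in E} ->
  t <= #|X| -> 2 * t <= #|Y| ->
  exists B : {set V}, [/\ B \subset X, #|B| = t & immersed B E (pairs B)].
Proof.
move=> dXY h tX tY; have [B /[!inE]/andP[BX /eqP Bt]] :
    exists B, B \in [set B : {set V} | B \subset X & #|B| == t].
  by apply/set0Pn; rewrite -card_gt0 cards_draws bin_gt0.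
exists B; split=> //; apply: hubs_immersed => b c bB cB _.
rewrite Bt; apply: leq_trans tY _; apply/subset_leq_card/subsetP=> y yY.
rewrite !inE !h ?(subsetP BX) // !andbT.
by apply: contraTN yY => yB; rewrite (disjointFr dXY) // (subsetP BX).
Qed.

End Hubs.

(** * Matchings *)

Section Matchings.
Variables (V : finType) (r : rel V).
Hypothesis r_sym : symmetric r.
Implicit Types (D : {set V}) (m n : {ffun V -> V}).

(* A matching is encoded as the involution swapping the two ends of each of
   its edges, so its fixed points are the unmatched vertices. *)
Definition matching D m := [forall x, m (m x) == x] &&
  [forall x, (m x != x) ==> (x \in D) && r x (m x)].

Definition missed D m := [set x in D | m x == x].

Lemma matchingP D m : reflect
  [/\ involutive m, forall x, m x != x -> x \in D
    & forall x, m x != x -> r x (m x)] (matching D m).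
Proof.
apply: (iffP andP) => [[/forallP h1 /forallP h2]|[h1 h2 h3]]; split=> //.
- by move=> x; apply/eqP.
- by move=> x hx; have /implyP/(_ hx)/andP[] := h2 x.
- by move=> x hx; have /implyP/(_ hx)/andP[] := h2 x.
- by apply/forallP=> x; rewrite h1.
- by apply/forallP=> x; apply/implyP=> hx; rewrite h2 ?h3.
Qed.

Lemma even_card_fixfree (m : V -> V) (X : {set V}) : involutive m ->
  {in X, forall x, m x \in X} -> {in X, forall x, m x != x} -> ~~ odd #|X|.
Proof.
move=> mK; have [k] := ubnP #|X|; elim: k X => // k IH X.
have [->|/set0Pn[x xX]] := eqVneq X set0; first by rewrite cards0.
rewrite ltnS => Xk mX fX.
have mxx : m x \in X :\ x by rewrite !inE fX ?mX.
rewrite (cardsD1 x) xX (cardsD1 (m x)) mxx /= negbK; apply: IH.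
- by move: Xk; rewrite (cardsD1 x) xX (cardsD1 (m x)) mxx; lia.
- move=> y; rewrite !inE => /and3P[ymx yx yX].
  by rewrite mX // andbT (can_eq mK) yx (can2_eq mK mK) ymx.
- by move=> y /[!inE]/and3P[_ _ /fX].
Qed.

Lemma matching_even D m : matching D m -> ~~ odd #|D :\: missed D m|.
Proof.
case/matchingP=> mK mD _; apply: (even_card_fixfree mK) => x; rewrite !inE.
  case: (x \in D); rewrite //= andbT => mx.
  have mmx : m (m x) != m x by rewrite (can_eq mK).
  by rewrite (negPf mmx) andbF mD.
by case: (x \in D); rewrite //= andbT.
Qed.

(** * The exchange step of Gallai's lemma *)

Section Gallai.
Variables (D : {set V}) (m n : {ffun V -> V}) (y : V).
Hypotheses (mm : matching D m) (mn : matching D n) (ny : n y = y).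
Hypothesis opt_m : forall m', matching D m' -> #|missed D m| <= #|missed D m'|.
Hypothesis opt_n : #|missed D n| = #|missed D m|.

(* The orbit of [y] under [n \o m] is the component of [y] in the union of
   the two matchings. *)
Let g x := n (m x).
Let P := [set x | fconnect g y x].

(** As [n] fixes [y], it reverses the orbit, sending [iter i g y] to the [i]-th preimage of [y];
    orbits of an injective map on a finite type are closed under preimages. *)
Lemma orbit_closed : {in P, forall x, m x \in P /\ n x \in P}.
Proof.
have [[mK _ _] [nK _ _]] := (matchingP _ _ mm, matchingP _ _ mn).
have g_inj : injective g by move=> a b /(can_inj nK)/(can_inj mK).
have step x : (m x \in P) = (n x \in P).
  rewrite !inE; have <- : g (m x) = n x by rewrite /g mK.
  by apply: same_fconnect1_r.
have all i : n (iter i g y) \in P.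
  elim: i => [|i IH] /=; first by rewrite ny inE connect0.
  by rewrite {1}/g nK step.
by move=> x /[1!inE] /iter_findex <-; rewrite step; split.
Qed.

(** [P] spans a path with [y] as an end missed by [n], so [m] misses at most one vertex of it. The
    proof computes with periods of [g]. *)
Lemma orbit_missed x z : m x = x -> m z = z -> x \in P -> z \in P -> x = z.
Proof.
have [[mK _ _] [nK _ _]] := (matchingP _ _ mm, matchingP _ _ mn).
have g_inj : injective g by move=> a b /(can_inj nK)/(can_inj mK).
have back i : iter i g (n (iter i g y)) = y.
  by elim: i => //= i IH; rewrite -iterS iterSr {2}/g nK {2}/g mK.
have per i : m (iter i g y) = iter i g y -> iter i.*2.+1 g y = y.
  move=> mi; have := back i.+1; rewrite [in n _]/= {2}/g nK mi -iterD.
  by rewrite addSn addnn.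
rewrite !inE => mx mz /iter_findex ex /iter_findex ez.
move: mx mz; rewrite -ex -ez; move: (findex _ _ _) (findex _ _ _) => i j.
wlog ij : i j / i <= j.
  by move=> w; case: (leqP i j) => [|/ltnW] h a b; [apply: w|symmetry; apply: w].
move=> /per pj /per pi; rewrite -(subnK ij) iterD.
set u := iter i g y; set e := j - i.
have shift k l : iter k g y = y -> iter k g (iter l g y) = iter l g y.
  by move=> h; rewrite -iterD addnC iterD h.
have pu : iter i.*2.+1 g u = u by apply: shift.
have qu : iter e.*2 g u = u.
  have := shift _ i pj; rewrite (_ : j.*2.+1 = e.*2 + i.*2.+1); last by rewrite /e; lia.
  by rewrite iterD pu.
have mul k a l : iter k g a = a -> iter (l * k) g a = a.
  by move=> h; elim: l => // l IH; rewrite mulSn iterD IH.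
(* The periods [i.*2.+1] and [e.*2] of [u] force the period [e], which identifies the two
   vertices. *)
have := mul _ u e pu; rewrite (_ : e * _ = e + i * e.*2); last by lia.
by rewrite iterD mul.
Qed.

(** [m] is replaced by [n] on [P], which contains [y] but not both [x] and [z]. The two possible
    mixtures of [m] and [n] together miss as many vertices as [m] and [n] do, so optimality makes
    both of them optimal. *)
Lemma switch_matching x z : x \in D -> y \in D ->
  m x = x -> m z = z -> x != z ->
  exists m', [/\ matching D m', #|missed D m'| = #|missed D m|, m' y = y
    & m' x = x \/ m' z = z].
Proof.
move=> xD yD mx mz xz.
have [[mK mD mr] [nK nD nr]] := (matchingP _ _ mm, matchingP _ _ mn).
have mix (a b : {ffun V -> V}) : matching D a -> matching D b ->
    {in P, forall u, a u \in P} -> {in P, forall u, b u \in P} ->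
    matching D [ffun u => if u \in P then a u else b u].
  case/matchingP=> aK aD ar /matchingP[bK bD br] aP bP.
  apply/matchingP; split=> [u|u|u]; rewrite !ffunE.
  - have [uP|uP] := boolP (u \in P); first by rewrite aP // aK.
    case: ifP => buP; rewrite ?bK //.
    by move: (bP _ buP); rewrite bK (negPf uP).
  - by case: ifP => _; [apply: aD|apply: bD].
  - by case: ifP => _; [apply: ar|apply: br].
have cardmix (a b : {ffun V -> V}) :
    #|missed D [ffun u => if u \in P then a u else b u]| =
    #|missed D a :&: P| + #|missed D b :\: P|.
  rewrite -(cardsID P); congr (_ + _); apply: eq_card => u; rewrite !inE ffunE inE;
  by case: (fconnect _ _ _); rewrite ?andbF ?andbT.
have mP : {in P, forall u, m u \in P} by move=> u /orbit_closed[].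
have nP : {in P, forall u, n u \in P} by move=> u /orbit_closed[].
have h1 := opt_m (mix _ _ mm mn mP nP).
have m1 := mix _ _ mn mm nP mP; have h2 := opt_m m1.
rewrite !cardmix in h1 h2.
exists [ffun u => if u \in P then n u else m u]; split=> //.
- rewrite cardmix; have := cardsID P (missed D m).
  by have := cardsID P (missed D n); rewrite opt_n; lia.
- by rewrite ffunE ny inE connect0.
- rewrite !ffunE; case: (boolP (x \in P)) => xP; [|by left].
  case: (boolP (z \in P)) => zP; [|by right].
  by move: xz; rewrite (orbit_missed mx mz xP zP) eqxx.
Qed.

End Gallai.

(** * The Tutte-Berge inequality and the use of its blocks *)

Definition separated (P : {set {set V}}) :=
  {in P &, forall X Y : {set V}, X != Y -> {in X & Y, forall x y, ~~ r x y}}.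

(* The hard inequality of the Tutte-Berge formula; the blocks of [P] need be
   neither connected nor odd. *)
Lemma tutte_berge D : exists m (S : {set V}) (P : {set {set V}}),
  [/\ matching D m, S \subset D, partition P (D :\: S), separated P
    & #|missed D m| + #|S| <= #|P|].
Proof.
have [k] := ubnP #|D|; elim: k D => // k IH D; rewrite ltnS => Dk.
have id0 : matching D (finfun id).
  by apply/matchingP; split=> x; rewrite !ffunE ?eqxx.
case: (arg_minnP (fun m : {ffun V -> V} => #|missed D m|) id0) => m mm opt.
pose maxm n := matching D n && (#|missed D n| == #|missed D m|).
(* If every maximum matching covers some [v], induction on [D :\ v] applies and [v] joins [S]. *)
have [/exists_inP[v vD /forallP hv]|/exists_inPn all] :=
  boolP [exists v in D, forall n, maxm n ==> (n v != v)].
  have [|m' [S [P [mm' SD pP sP cP]]]] := IH (D :\ v).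
    by move: Dk; rewrite (cardsD1 v) vD.
  have vS : v \notin S by apply/negP=> /(subsetP SD); rewrite !inE eqxx.
  have mv : m' v = v.
    have [_ h _] := matchingP _ _ mm'.
    by apply/eqP; apply: contraTT isT => /h; rewrite !inE eqxx.
  have mmD : matching D m'.
    case/matchingP: mm' => h1 h2 h3; apply/matchingP; split=> // x /h2.
    by case/setD1P.
  have eqm : missed D m' = v |: missed (D :\ v) m'.
    apply/setP=> x; rewrite !inE.
    by have [->|] := eqVneq x v; rewrite ?orbF //= vD mv eqxx.
  have cm : #|missed D m'| = #|missed (D :\ v) m'|.+1.
    by rewrite eqm cardsU1 !inE eqxx.
  (* [m'] misses [v], so it is not maximum in [D]; by parity it misses at least two vertices more
     than [m]. One of them is [v] itself, the other pays for [v] in [S]. *)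
  have neq : #|missed D m'| != #|missed D m|.
    by have := hv m'; rewrite /maxm mmD mv eqxx implybF.
  have := opt _ mmD; have := matching_even mm; have := matching_even mmD.
  have sub n : missed D n \subset D by apply/subsetP=> x /[!inE]/andP[].
  rewrite !cardsDS //; have := subset_leq_card (sub m); have := subset_leq_card (sub m').
  exists m, (v |: S), P; split=> //.
  - by rewrite subUset sub1set vD (subset_trans SD) // subD1set.
  - by rewrite -setDDl.
  - by rewrite cardsU1 vS; lia.
have {}all x : x \in D ->
    exists n, [/\ matching D n, #|missed D n| = #|missed D m| & n x = x].
  move=> /all/forallPn[n]; rewrite negb_imply negbK => /andP[/andP[h1 /eqP h2] /eqP h3].
  by exists n.
(* Now each vertex of [D] is missed by some maximum matching. By the exchange step, never being
   missed together is an equivalence; its classes are the blocks, and [S] is empty. *)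
pose apart x y := [exists n, [&& maxm n, n x == x & n y == y]].
pose R x y := (x == y) || ~~ apart x y.
have R_sym x y : R x y = R y x.
  rewrite /R eq_sym; congr (_ || ~~ _); apply/eq_existsb => n.
  by congr (_ && _); apply: andbC.
have R_trans x y z : x \in D -> y \in D -> z \in D -> R x y -> R y z -> R x z.
  rewrite /R; have [->|xy] //= := eqVneq x y; have [->|yz] //= := eqVneq y z.
    by move=> *; apply/orP; right.
  move=> xD yD zD nxy nyz; have [//|xz /=] := eqVneq x z.
  apply/negP=> /existsP[n /and3P[/andP[mn /eqP cn] /eqP nx /eqP nz]].
  have [l [ml cl ly]] := all _ yD.
  have [||m' [mm' cm' m'y]] := @switch_matching D n l y mn ml ly _ _ x z xD yD nx nz xz.
  - by move=> m' /opt; rewrite cn.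
  - by rewrite cl cn.
  rewrite cn in cm'; case=> [m'x|m'z].
    by case/negP: nxy; apply/existsP; exists m'; rewrite /maxm mm' cm' m'x m'y !eqxx.
  by case/negP: nyz; apply/existsP; exists m'; rewrite /maxm mm' cm' m'z m'y !eqxx.
have R_equiv : {in D & &, equivalence_rel R}.
  move=> x y z xD yD zD; split; first by rewrite /R eqxx.
  by move=> xy; apply/idP/idP; apply: R_trans => //; rewrite R_sym.
have PD := equivalence_partitionP R_equiv; set P := equivalence_partition R D in PD.
have PE x y : x \in D -> y \in D -> (y \in pblock P x) = R x y.
  by move=> xD yD; rewrite /P (pblock_equivalence_partition R_equiv).
have /and3P[/eqP covP tiP _] := PD.
exists m, set0, P; split=> //.
- exact: sub0set.
- by rewrite setD0.
- move=> X Y XP YP XY x y xX yY; apply: contra XY => rxy.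
  have xD : x \in D by rewrite -covP; apply/bigcupP; exists X.
  have yD : y \in D by rewrite -covP; apply/bigcupP; exists Y.
  rewrite -(def_pblock tiP XP xX) -(def_pblock tiP YP yY) eq_pblock ?covP //.
  rewrite PE // /R; have [//|xy /=] := eqVneq x y.
  apply/existsP=> -[n /and3P[/andP[mn /eqP cn] /eqP nx /eqP ny]].
  have [nK nD nr] := matchingP _ _ mn.
  (* A related pair missed by the maximum matching [n] could be added to it. *)
  pose n' := [ffun u => if u == x then y else if u == y then x else n u].
  have n'E u : n' u = if u == x then y else if u == y then x else n u by rewrite ffunE.
  have mn' : matching D n'.
    have nxy u : u != x -> u != y -> (n u != x) && (n u != y).
      by rewrite -(can_eq nK u) nx -(can_eq nK u y) ny => -> ->.
    apply/matchingP; split=> [u|u|u]; rewrite ?n'E.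
    - have [->|ux] := eqVneq u x; first by rewrite eqxx eq_sym (negPf xy).
      have [->|uy] := eqVneq u y; first by rewrite eqxx.
      by have /andP[/negPf-> /negPf->] := nxy _ ux uy; rewrite nK.
    - by have [->//|ux] := eqVneq u x; have [->//|uy] := eqVneq u y; apply: nD.
    - have [->//|ux] := eqVneq u x; have [->|uy] := eqVneq u y; last exact: nr.
      by rewrite r_sym.
  have := opt _ mn'; rewrite -cn leqNgt => /negP[].
  apply: proper_card; apply/properP; split; last first.
    by exists x; rewrite !inE xD ?nx ?eqxx // n'E eqxx eq_sym (negPf xy).
  apply/subsetP=> u; rewrite !inE n'E => /andP[->].
  have [->|ux] := eqVneq u x; first by rewrite eq_sym (negPf xy).
  by have [->|uy] := eqVneq u y; first by rewrite (negPf xy).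
- rewrite cards0 addn0; set M := missed D m.
  (* Vertices missed by [m] are missed together, hence lie in different blocks. *)
  have inj : {in M &, injective (pblock P)}.
    move=> x y /[!inE]/andP[xD /eqP mx] /andP[yD /eqP my] e.
    have : y \in pblock P x by rewrite e mem_pblock covP.
    rewrite PE // /R => /orP[/eqP//|/negP[]]; apply/existsP; exists m.
    by rewrite /maxm mm mx my !eqxx.
  rewrite -(card_in_imset inj) subset_leq_card //; apply/subsetP=> _ /imsetP[x + ->].
  by rewrite inE => /andP[xD _]; apply: pblock_mem; rewrite covP.
Qed.

Lemma card_cover_ge (P : {set {set V}}) (U : {set V}) (Q : {set {set V}}) :
  partition P U -> Q \subset P -> #|Q| <= #|cover Q|.
Proof.
case/and3P=> _ tiP P0 QP; have /eqP <- : trivIset Q by apply: trivIsetS tiP.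
rewrite -sum1_card; apply: leq_sum => X XQ; rewrite card_gt0.
by apply: contraNneq P0 => <-; apply: (subsetP QP).
Qed.

Lemma cover_setD (P : {set {set V}}) (U : {set V}) (Q : {set {set V}}) :
  partition P U -> Q \subset P -> cover (P :\: Q) = U :\: cover Q.
Proof.
case/and3P=> /eqP <- tiP _ QP; apply/setP=> x; rewrite inE; apply/bigcupP/andP.
  case=> X /setDP[XP XQ] xX; split; last by apply/bigcupP; exists X.
  apply: contra XQ => /bigcupP[Y YQ xY].
  by rewrite -(def_pblock tiP XP xX) (def_pblock tiP (subsetP QP _ YQ) xY).
case=> nQ /bigcupP[X XP xX]; exists X; rewrite // inE XP andbT.
by apply: contra nQ => XQ; apply/bigcupP; exists X.
Qed.

(** Let [C] be a largest block. The other blocks number more than [s] and their union is [X] if it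
    has fewer than [t] elements or if [C] has at least [2 * t]. Otherwise [X] is the union of a
    minimal family of blocks covering at least [t] vertices. *)
Lemma split_blocks t s (U : {set V}) (P : {set {set V}}) : 0 < t ->
  partition P U -> separated P -> s + 2 <= #|P| -> 8 * t <= #|U| + s ->
  exists X : {set V}, [/\ X \subset U, {in X & U :\: X, forall x y, ~~ r x y}
    & (t <= #|X| /\ 2 * t <= #|U :\: X|) \/ (s < #|X| < t)].
Proof.
move=> t0 pP sP sq tU; have /and3P[/eqP covP tiP P0] := pP.
have sepQ (Q : {set {set V}}) : Q \subset P -> cover Q \subset U /\
    {in cover Q & U :\: cover Q, forall x y, ~~ r x y}.
  move=> QP; split.
    by rewrite -covP; apply/bigcupsP=> X XQ; apply: bigcup_sup (subsetP QP _ XQ).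
  move=> x y /bigcupP[X XQ xX]; rewrite -(cover_setD pP QP).
  case/bigcupP=> Y /setDP[YP YQ] yY.
  by apply: (sP X Y) => //; [apply: (subsetP QP)|apply: contraNneq YQ => <-].
have [C0 C0P] : exists C0, C0 \in P by apply/set0Pn; rewrite -card_gt0; lia.
case: (arg_maxnP (fun X : {set V} => #|X|) C0P) => C; rewrite -[_ C]/(C \in P) => CP maxC.
have QC : P :\ C \subset P by apply: subD1set.
have [sC dC] := sepQ _ QC.
have UC : U :\: cover (P :\ C) = C.
  rewrite -(cover_setD pP QC) setDDr setDv set0U.
  by rewrite (setIidPr _) ?sub1set // /cover big_set1.
have := card_cover_ge pP QC; rewrite [#|_ :\ _|](_ : _ = #|P|.-1); last first.
  by rewrite (cardsD1 C P) CP.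
move=> cC; have [lt|ge] := ltnP #|cover (P :\ C)| t.
  by exists (cover (P :\ C)); split=> //; right; lia.
have [C2|C2] := leqP (2 * t) #|C|.
  by exists (cover (P :\ C)); split=> //; left; rewrite UC.
have exQ : exists Q, [pred Q : {set {set V}} | (Q \subset P) && (t <= #|cover Q|)] Q.
  by exists (P :\ C); rewrite /= QC ge.
have [Q /minsetP[/andP[QP tQ] minQ]] := ex_minset exQ.
have [sQ dQ] := sepQ _ QP; exists (cover Q); split=> //; left; split=> //.
have tiQ : trivIset Q by apply: trivIsetS tiP.
have [B BQ] : exists B, B \in Q.
  by apply/set0Pn; apply: contraTneq tQ => ->; rewrite /cover big_set0 cards0 -ltnNge.
have QBP : Q :\ B \subset P by apply: subset_trans QP; apply: subD1set.
have QB : #|cover (Q :\ B)| < t.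
  rewrite ltnNge; apply/negP=> h; have := minQ (Q :\ B); rewrite /= QBP h subD1set.
  by move=> /(_ isT isT)/setP/(_ B); rewrite !inE eqxx BQ.
have cQ : #|cover Q| = #|B| + #|cover (Q :\ B)|.
  rewrite -(eqP tiQ) (big_setD1 B) //=; congr (_ + _).
  by apply/eqP/(trivIsetS _ tiQ)/subD1set.
have cB := maxC _ (subsetP QP _ BQ).
have q1 := card_cover_ge pP QBP.
have q2 : #|Q| = #|Q :\ B|.+1 by rewrite (cardsD1 B Q) BQ.
(* [cover Q] has at most [3 * t] vertices and [Q] at most [t] blocks. So the rest of [U] has at
   least [5 * t - s] vertices, and at least [s + 2 - t] by counting blocks; one of the two bounds is
   at least [2 * t]. *)
have := card_cover_ge pP (subsetDl P Q); rewrite (cover_setD pP QP) !cardsDS //.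
have := subset_leq_card QP; have := subset_leq_card sQ; lia.
Qed.

End Matchings.

(** * Splitting off a vertex *)

Section Splitting.
Variable V : finType.
Implicit Types (E F : {set {set V}}) (U A X Z : {set V}) (a p x y u w : V).

Definition simple E := {in E, forall e : {set V}, #|e| = 2}.

Definition non_edge E : rel V := fun x y => (x != y) && ([set x; y] \notin E).

Lemma non_edge_sym E : symmetric (non_edge E).
Proof. by move=> x y; rewrite /non_edge eq_sym setUC. Qed.

Lemma simple_neq E x y : simple E -> [set x; y] \in E -> x != y.
Proof. by move=> sE /sE; rewrite cards2; case: (x != y). Qed.

(** * Trading a walk of length three for an edge *)

Section Detour.
Variables (E : {set {set V}}) (a p x y : V).
Hypotheses (xa : [set x; a] \in E) (ap : [set a; p] \in E) (py : [set p; y] \in E).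
Hypotheses (sE : simple E) (xy : non_edge E x y) (yNa : y != a).

Definition detour := [set x; y] |: E :\: [set [set x; a]; [set a; p]; [set p; y]].

Lemma detour_simple : simple detour.
Proof.
move=> e; rewrite !inE => /orP[/eqP->|/andP[_ /sE//]].
by rewrite cards2; case/andP: xy => ->.
Qed.

Lemma detour_immersed Z : a \notin Z -> p \notin Z -> immersed Z E detour.
Proof.
move=> aZ pZ; have /andP[_ xyE] := xy.
exists (fun e => if e == [set x; y]
  then [set [set x; a]; [set a; p]; [set p; y]] else [set e]).
split.
- move=> e eD; case: eqP => [_|/eqP ne]; first by rewrite !subUset !sub1set xa ap py.
  by move: eD; rewrite sub1set in_setU1 (negPf ne) => /setDP[].
- move=> e f; rewrite ![_ \in detour]in_setU1.
  case: eqP => [->|_] /= eD; case: eqP => [->|_] /= fD; rewrite ?eqxx // => ef.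
  + by rewrite disjoint_sym disjoints1; case/setDP: fD.
  + by rewrite disjoints1; case/setDP: eD.
  + by rewrite disjoints1 inE.
- move=> u w uw; case: eqP => [euw|_]; last by apply: connected_by1; rewrite inE.
  have := euw => /eqP; rewrite eqset2 => /orP[]/andP[/eqP-> /eqP->].
    apply: (connected_by_trans aZ); first by apply: connected_by1; rewrite !inE eqxx.
    by apply: (connected_by_trans pZ); apply: connected_by1; rewrite !inE eqxx ?orbT.
  apply: (connected_by_trans pZ); last first.
    apply: (connected_by_trans aZ); apply: connected_by1;
      by rewrite (setUC [set p], setUC [set a]) !inE eqxx ?orbT.
  by apply: connected_by1; rewrite (setUC [set y]) !inE eqxx ?orbT.
Qed.

Let xNa : x != a. Proof. exact: simple_neq sE xa. Qed.
Let aNp : a != p. Proof. exact: simple_neq sE ap. Qed.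

Lemma nbr_detour u : u != a -> u != p ->
  nbr detour u = if u == x then y |: nbr E u :\ a
    else if u == y then x |: nbr E u :\ p else nbr E u.
Proof.
move=> ua up; apply/setP=> w; have /andP[xNy _] := xy.
rewrite !inE !eqset2 (negPf ua) (negPf up) /= !orbF.
have [->|ux] := eqVneq u x.
  by rewrite (negPf xNy) /= !inE orbF; case: (w == y); case: (w == a).
by have [->|uy] := eqVneq u y; rewrite !inE /=.
Qed.

Lemma detour_deg u : u != a -> u != p -> #|nbr E u| <= #|nbr detour u|.
Proof.
move=> ua up; rewrite nbr_detour //; have /andP[_ xyE] := xy.
have [->|ux] := eqVneq u x.
  by rewrite cardsU1 (cardsD1 a (nbr E x)) !inE xa negb_and xyE orbT.
have [->//|//] := eqVneq u y.
rewrite cardsU1 (cardsD1 p (nbr E y)) !inE (setUC _ [set p]) py.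
by rewrite negb_and (setUC _ [set x]) xyE orbT.
Qed.

Lemma detour_new X u : #|nbr detour u :\: X| <= #|nbr E u :\: X|.+1.
Proof.
(* Only [x] and [y] gain a neighbour, namely each other; for other [u] the extra [x] is harmless. *)
have sub : {subset nbr detour u <= (if u == x then y else x) |: nbr E u}.
  move=> w; rewrite inE /detour !in_setU1 eqset2.
  case/orP=> [|/setDP[uw _]]; last by rewrite !inE uw orbT.
  case: eqVneq => [->|_] /=; last by case/andP=> _ ->.
  by case/orP=> [->//|/andP[/eqP<- ->]].
apply: leq_trans (_ : #|(if u == x then y else x) |: nbr E u :\: X| <= _).
  apply/subset_leq_card/subsetP=> w; rewrite !in_setD in_setU1 => /andP[wX /sub].
  by rewrite in_setU1 in_setD wX.
by rewrite cardsU1; lia.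
Qed.

Lemma nbr_detour_centre A : p \in A -> nbr detour a :\: A = (nbr E a :\: A) :\ x.
Proof.
move=> pA.
have [ax ay ap'] : [/\ (a == x) = false, (a == y) = false & (a == p) = false].
  by split; rewrite // ?(eq_sym a x) ?(eq_sym a y) ?(negPf xNa) ?(negPf yNa) ?(negPf aNp).
apply/setP=> w; rewrite !inE !eqset2 ax ay ap' eqxx /= !orbF.
by case: (eqVneq w p) => [->|_]; rewrite ?pA ?andbF ?orbF // andbCA.
Qed.

Lemma detour_kept u w : [set u; w] \in E -> [set u; w] != [set x; a] ->
  [set u; w] != [set a; p] -> [set u; w] != [set p; y] -> [set u; w] \in detour.
Proof. by rewrite !in_setU1 !inE => -> /negPf-> /negPf-> /negPf->; rewrite orbT. Qed.

End Detour.

(** * Splitting off along a matching of non-edges *)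

Section SplitOff.
Variables (E : {set {set V}}) (D : {set V}) (a : V) (m : {ffun V -> V}).
Hypotheses (sE : simple E) (DN : D \subset nbr E a) (mm : matching (non_edge E) D m).

Definition split_off :=
  [set e in E | a \notin e] :|: [set [set u; m u] | u in D & m u != u].

Let aND : a \notin D.
Proof.
by apply/negP=> /(subsetP DN); rewrite inE => /(simple_neq sE); rewrite eqxx.
Qed.

Let mD u : m u != u -> [/\ u \in D, m u \in D & u != a].
Proof.
have [mK h _] := matchingP _ _ _ mm => mu; split; first exact: h.
  by apply: h; rewrite (can_eq mK).
by apply: contraTneq (h _ mu) => ->.
Qed.

Let new_edge u w :
  [set u; w] \in [set [set v; m v] | v in D & m v != v] -> w = m u.
Proof.
have [mK _ _] := matchingP _ _ _ mm.
move=> /imsetP[v _ e]; case: (set2_inj e) => -[-> ->] //.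
Qed.

Lemma split_off_simple : simple split_off.
Proof.
move=> e /setUP[]; first by rewrite inE => /andP[/sE].
by case/imsetP=> u /[!inE]/andP[_ mu] ->; rewrite cards2 eq_sym mu.
Qed.

Lemma split_off_sub U : {in E, forall e : {set V}, e \subset U} -> a \in U ->
  {in split_off, forall e : {set V}, e \subset U :\ a}.
Proof.
move=> EU aU e /setUP[].
  by rewrite inE => /andP[/EU eU ae]; rewrite subsetD1 eU ae.
case/imsetP=> u /[!inE]/andP[_ mu] ->; have [uD muD _] := mD mu.
have DU : D \subset U :\ a.
  apply/subsetP=> v vD; rewrite !inE; have := subsetP DN _ vD; rewrite inE => /EU.
  rewrite subUset !sub1set => /andP[_ ->]; rewrite andbT.
  by apply: contraTneq vD => ->.
by rewrite subUset !sub1set !(subsetP DU).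
Qed.

Lemma nbr_split_off u : u != a ->
  nbr split_off u = if m u == u then nbr E u :\ a else m u |: nbr E u :\ a.
Proof.
move=> ua; have [mK _ _] := matchingP _ _ _ mm.
apply/setP=> w; have -> : (w \in nbr split_off u) =
    (w != a) && (w \in nbr E u) || (m u != u) && (w == m u).
  rewrite inE in_setU; congr (_ || _).
    by rewrite !inE negb_or (eq_sym a u) ua (eq_sym a w) andbC.
  apply/idP/andP => [h|[mu /eqP->]].
    have wm := new_edge h; split; last by rewrite wm.
    case/imsetP: h => v /[!inE]/andP[_ mv] e.
    by rewrite -wm; case: (set2_inj e) => -[-> ->]; rewrite // eq_sym.
  by apply/imsetP; exists u => //; rewrite inE mu andbT; have [] := mD mu.
by case: (eqVneq (m u) u) => mu; rewrite !inE /= ?orbF // orbC.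
Qed.

(** A new edge runs through [a]. The edge [[set z; a]] serves only the new edge at [z], unique
    because [m] is a matching, and the old edges that are kept avoid [a]. *)
Lemma split_off_immersed Z : a \notin Z -> immersed Z E split_off.
Proof.
move=> aZ; have [mK _ mr] := matchingP _ _ _ mm.
have newE e : e \in split_off -> e \notin E ->
    exists u, [/\ e = [set u; m u], m u != u & e \subset D].
  case/setUP; first by rewrite inE => /andP[->].
  case/imsetP=> u /[!inE]/andP[uD mu] -> _; exists u; split=> //.
  by have [_ muD _] := mD mu; rewrite subUset !sub1set uD muD.
have oldE e : e \in split_off -> e \in E -> a \notin e.
  case/setUP; first by rewrite inE => /andP[].
  case/imsetP=> u /[!inE]/andP[uD mu] ->.
  by have := mr _ mu => /andP[_ /negPf->].
exists (fun e => if e \in E then [set e] else [set [set z; a] | z in e]); split.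
- move=> e eS; case: ifPn => [|eE]; first by rewrite sub1set.
  have [u [_ _ /subsetP eD]] := newE _ eS eE; apply/subsetP=> _ /imsetP[z /eD zD ->].
  by have := subsetP DN _ zD; rewrite inE setUC.
- have mix e f : e \in split_off -> e \in E ->
      [disjoint [set e] & [set [set z; a] | z in f : {set V}]].
    move=> eS eE; rewrite disjoints1; apply/imsetP=> -[z _ ez].
    by have := oldE _ eS eE; rewrite ez !inE eqxx orbT.
  move=> e f eS fS ef; case: ifPn => eE; case: ifPn => fE.
  + by rewrite disjoints1 inE.
  + exact: mix.
  + by rewrite disjoint_sym; apply: mix.
  + have [u [ee mu eD]] := newE _ eS eE; have [w [fw mw fD]] := newE _ fS fE.
    apply/pred0P=> g /=; apply/negP=> /andP[/imsetP[z ze ->] /imsetP[z' z'f /eqP]].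
    have za : z != a by apply: contraTneq (subsetP eD _ ze) => ->.
    rewrite eqset2 (negPf za) andFb orbF eqxx andbT => /eqP zz; subst z'.
    have val v k : z \in [set v; m v] -> k = [set v; m v] -> k = [set z; m z].
      by rewrite !inE => /orP[]/eqP-> ->; rewrite ?mK // setUC.
    move: ef; rewrite (val u e) -?ee // (val w f) -?fw // ?eqxx //.
- move=> u w uwS; case: ifPn => [uwE|_]; first by apply: connected_by1; rewrite inE.
  apply: (connected_by_trans aZ); apply: connected_by1.
    by apply/imsetP; exists u; rewrite ?set21.
  by rewrite setUC; apply/imsetP; exists w; rewrite ?set22.
Qed.

Lemma split_off_deg u : u != a -> (u \in nbr E a -> m u != u) ->
  #|nbr E u| <= #|nbr split_off u|.
Proof.
move=> ua h; have [_ _ mr] := matchingP _ _ _ mm.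
have Da : #|nbr E u| = (u \in nbr E a) + #|nbr E u :\ a| by rewrite (cardsD1 a) nbr_sym.
rewrite nbr_split_off // Da; case: (eqVneq (m u) u) => mu.
  by move: h; rewrite mu eqxx; case: (u \in _) => // /(_ isT).
have /andP[_ muE] := mr _ mu.
by rewrite cardsU1 !inE negb_and muE orbT leq_add2r leq_b1.
Qed.

Lemma split_off_deg_missed u : u != a -> #|nbr E u| <= #|nbr split_off u|.+1.
Proof.
move=> ua; rewrite nbr_split_off // (cardsD1 a).
case: ifP => _; first by case: (a \in _).
by rewrite cardsU1; case: (a \in _); lia.
Qed.

Lemma split_off_new X u : u != a -> #|nbr split_off u :\: X| <= #|nbr E u :\: X|.+1.
Proof.
move=> ua; apply: leq_trans (_ : #|m u |: nbr E u :\: X| <= _).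
  apply/subset_leq_card/subsetP=> w; rewrite nbr_split_off //.
  case: ifP => _; rewrite !inE;
    by case: (w == m u); case: (w == a); case: (w \in X).
by rewrite cardsU1; lia.
Qed.

End SplitOff.
End Splitting.

(** * Clusters *)

Lemma min_degree_le (G : sgraph) (x : G) : min_degree G <= degree x.
Proof.
rewrite /min_degree; have := mem_index_enum x.
elim: (index_enum _) => // y s IH; rewrite big_cons inE => /orP[/eqP<-|/IH h].
  exact: geq_minl.
exact: leq_trans (geq_minr _ _) h.
Qed.

Section Cluster.
Variables (V : finType) (E0 : {set {set V}}) (t : nat).
Hypothesis t_gt0 : 0 < t.
Implicit Types (E : {set {set V}}) (U H W R : {set V}) (A : seq V).

Let d := 11 * t + 6.

Definition has_clique := exists B : {set V}, #|B| = t /\ immersed B E0 (pairs B).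

Definition almost_regular U E v :=
  [/\ simple E, {in E, forall e : {set V}, e \subset U},
  v \in U, d <= #|nbr E v| & {in U, forall u, u != v -> d < #|nbr E u|}].

(** Every stack vertex but the last has a neighbour further down, which will serve as the [p] of a
    detour. *)
Fixpoint stacked E A := if A is a :: A' then
  ((A' == [::]) || has (fun p => [set a; p] \in E) A') && stacked E A' else true.

Lemma stacked_cat E (rs : seq V) a A' : stacked E (a :: A') ->
  {in rs, forall r, [set a; r] \in E} -> stacked E (rs ++ a :: A').
Proof.
move=> st; elim: rs => //= r rs IH h; apply/andP; split.
  apply/orP; right; apply/hasP; exists a; first by rewrite mem_cat mem_head orbT.
  by rewrite setUC h ?mem_head.
by apply: IH => q qrs; apply: h; rewrite inE qrs orbT.
Qed.

Lemma stacked_kept E E' A :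
  {in A &, forall u w, [set u; w] \in E -> [set u; w] \in E'} ->
  stacked E A -> stacked E' A.
Proof.
elim: A => //= a A IH h /andP[ha sA]; apply/andP; split.
  case/orP: ha => [->//|/hasP[p pA ap]]; apply/orP; right; apply/hasP; exists p => //.
  by apply: h ap; rewrite inE ?eqxx // pA orbT.
by apply: IH sA => u w uA wA; apply: h; rewrite inE ?uA ?wA orbT.
Qed.

(** The graph from which the cluster was started; [outer] is the induction hypothesis for smaller
    vertex sets. *)
Variables (E1 : {set {set V}}) (U1 : {set V}).
Hypothesis imm1 : immersed U1 E0 E1.
Hypothesis outer : forall U E v, U \proper U1 -> immersed U E0 E ->
  almost_regular U E v -> has_clique.

(* [A] is the stack of cluster vertices still to be removed, [H] the set of
   all cluster vertices so far; [#|H| - size A] counts the removed ones.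
   [cl_card] holds since [W] starts with at least [d] elements and loses at
   most two per vertex joining [H] and one per vertex removed. *)
Record cluster E U A H W : Prop := Cluster {
  cl_immersed : immersed (U :\: [set x in A]) E0 E;
  cl_simple : simple E;
  cl_sub : {in E, forall e : {set V}, e \subset U};
  cl_U : U \subset U1;
  cl_uniq : uniq A;
  cl_AU : {subset A <= U};
  cl_stacked : stacked E A;
  cl_deg : {in U, forall u, u \notin A -> d < #|nbr E u|};
  cl_WU : W \subset U;
  cl_WH : [disjoint W & H];
  cl_adj : {in A & W, forall a w, [set a; w] \in E};
  cl_AH : {subset A <= H};
  cl_HU1 : H \subset U1;
  cl_HU : {in H, forall h, h \in U -> h \in A};
  cl_card : d + 2 + size A <= #|W| + 3 * #|H|;
  cl_W : 6 * t <= #|W|;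
  cl_removed : #|H| - size A <= t;
  cl_miss : {in H, forall h, #|W :\: nbr E1 h| <= 2 * (#|H| - size A)};
  cl_new : {in U, forall u, #|nbr E u :\: nbr E1 u| <= 2 * (#|H| - size A)} }.

Lemma cluster_size E U A H W : cluster E U A H W -> size A <= #|H|.
Proof.
move=> c; rewrite -(card_uniqP (cl_uniq c)); apply/subset_leq_card/subsetP.
exact: cl_AH c.
Qed.

(** Each cluster vertex misses at most [2 * t] of the at least [6 * t] vertices of [W], so any two
    share [2 * t] neighbours. This is measured in [E1], where removed cluster vertices are still
    present. *)
Lemma cluster_full E U A H W : cluster E U A H W -> t <= #|H| -> has_clique.
Proof.
move=> c tH.
have [B /[!inE]/andP[BH /eqP Bt]] :
    exists B, B \in [set B : {set V} | B \subset H & #|B| == t].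
  by apply/set0Pn; rewrite -card_gt0 cards_draws bin_gt0.
exists B; split=> //; apply: (@immersed_trans _ _ _ E1).
  by apply: immersedS imm1 => //; apply: subset_trans (cl_HU1 c).
apply: hubs_immersed => b b' bB b'B _; rewrite Bt.
have m1 := cl_miss c (subsetP BH _ bB); have m2 := cl_miss c (subsetP BH _ b'B).
have cW := cl_W c; have cr := cl_removed c.
have sub : (W :\: (W :\: nbr E1 b)) :\: (W :\: nbr E1 b') \subset
    (nbr E1 b :&: nbr E1 b') :\: B.
  apply/subsetP=> w; rewrite !in_setD in_setI => /and3P[+ + wW].
  rewrite wW !andbT !negbK => -> ->; rewrite !andbT.
  by apply/negP=> /(subsetP BH); rewrite (disjointFr (cl_WH c) wW).
have := subset_leq_card sub.
have := cardsD_lb (W :\: (W :\: nbr E1 b)) (W :\: nbr E1 b').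
have := cardsD_lb W (W :\: nbr E1 b); lia.
Qed.

(** In [cl_card] the gain [3 * #|R|] pays for [#|R|] new stack vertices and [2 * #|R|] vertices lost
    from [W]. *)
Lemma cluster_grow E U a A' H W W' R : cluster E U (a :: A') H W -> #|H| < t ->
  R \subset nbr E a :\: [set x in a :: A'] -> #|R| <= t ->
  W' \subset W -> [disjoint W' & R] -> #|W| <= #|W'| + 2 * #|R| ->
  {in R & W', forall r w, [set r; w] \in E} ->
  cluster E U (enum R ++ a :: A') (H :|: R) W'.
Proof.
move=> c Ht RD Rt W'W dW cW' RW'; set A := a :: A' in c RD *.
have RU : R \subset U.
  apply/subsetP=> r /(subsetP RD) /[!inE]/andP[_ /(cl_sub c)].
  by rewrite subUset !sub1set => /andP[].
have RA r : r \in R -> r \notin A by move=> /(subsetP RD); rewrite 3!inE => /andP[].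
have RH r : r \in R -> r \notin H.
  by move=> rR; apply: contra (RA _ rR) => rH; rewrite (cl_HU c) ?(subsetP RU).
have cHR : #|H :|: R| = #|H| + #|R|.
  rewrite cardsU (_ : H :&: R = set0) ?cards0 ?subn0 //.
  by apply/setP=> r; rewrite !inE; apply/negP=> /andP[rH /RH]; rewrite rH.
have sA : size (enum R ++ A) = #|R| + size A by rewrite size_cat -cardE.
have mA u : (u \in enum R ++ A) = (u \in R) || (u \in A) by rewrite mem_cat mem_enum.
have diff : #|H :|: R| - size (enum R ++ A) = #|H| - size A by rewrite cHR sA; lia.
have cA := cl_card c; have szA := cluster_size c.
split; rewrite ?diff.
- apply: immersedS (cl_immersed c) => //; apply/subsetP=> u.
  by rewrite !in_setD !inE mA negb_or => /andP[/andP[_ ->]].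
- exact: cl_simple c.
- exact: cl_sub c.
- exact: cl_U c.
- rewrite cat_uniq enum_uniq (cl_uniq c) andbT andTb; apply/hasPn=> u uA.
  by rewrite mem_enum; apply: contraL uA; apply: RA.
- by move=> u; rewrite mA => /orP[/(subsetP RU)|/(cl_AU c)].
- apply: stacked_cat (cl_stacked c) _ => r; rewrite mem_enum => /(subsetP RD).
  by rewrite !inE => /andP[_].
- by move=> u uU; rewrite mA negb_or => /andP[_]; apply: cl_deg c _ uU.
- exact: subset_trans W'W (cl_WU c).
- rewrite -setI_eq0 setIUr setU_eq0 !setI_eq0 dW andbT.
  exact: disjointWl W'W (cl_WH c).
- move=> u w; rewrite mA => /orP[uR|uA] wW'; first exact: RW'.
  by apply: (cl_adj c) => //; apply: (subsetP W'W).
- by move=> u; rewrite mA in_setU => /orP[->|/(cl_AH c)->]; rewrite ?orbT.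
- by rewrite subUset (cl_HU1 c) (subset_trans RU (cl_U c)).
- move=> u; rewrite mA in_setU => /orP[uH uU|->//].
  by rewrite (cl_HU c) ?orbT.
- by rewrite cHR sA; lia.
- by rewrite /d in cA *; lia.
- exact: cl_removed c.
- move=> u /setUP[uH|uR].
    by apply: leq_trans (cl_miss c uH); apply/subset_leq_card/setSD.
  (* A new cluster vertex is complete to [W'] in [E], so what it misses there in [E1] are neighbours
     gained since. *)
  apply: leq_trans (cl_new c (subsetP RU _ uR)); apply/subset_leq_card/subsetP=> w.
  by rewrite !in_setD => /andP[->] wW' /=; rewrite inE RW'.
- exact: cl_new c.
Qed.

(** Common bookkeeping for splitting off [a] directly or after a detour. *)
Lemma cluster_remove E U a A' H W E' W' : cluster E U (a :: A') H W -> #|H| < t ->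
  (forall Z : {set V}, a \notin Z -> [disjoint Z & [set x in A']] -> immersed Z E E') ->
  simple E' -> {in E', forall e : {set V}, e \subset U :\ a} ->
  {in U, forall u, u \notin a :: A' -> #|nbr E u| <= #|nbr E' u|} ->
  (forall u (X : {set V}), u \in U -> u != a ->
    #|nbr E' u :\: X| <= #|nbr E u :\: X| + 2) ->
  W' \subset W -> #|W| <= #|W'|.+1 ->
  {in A' & W', forall p w, [set p; w] \in E -> [set p; w] \in E'} ->
  {in A' &, forall p w, [set p; w] \in E -> [set p; w] \in E'} ->
  cluster E' (U :\ a) A' H W'.
Proof.
move=> c Ht imm sE' subE' deg' new' W'W cW' keepW keepA.
have szA := cluster_size c; have cA := cl_card c; rewrite /= in szA cA.
have /andP[aA' uA'] := cl_uniq c.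
have sub1 u : u \in A' -> u \in a :: A' by rewrite inE orbC => ->.
have aU : a \in U by apply: (cl_AU c); rewrite mem_head.
split.
- have dis : (U :\ a) :\: [set x in A'] \subset U :\: [set x in a :: A'].
    by apply/subsetP=> u; rewrite !inE negb_or => /and3P[-> -> ->].
  apply: (@immersed_trans _ _ _ E); first by apply: immersedS (cl_immersed c).
  apply: imm; first by rewrite !inE eqxx andbF.
  by apply/pred0P=> u; rewrite /= !inE; case: (u \in A'); rewrite ?andbF.
- exact: sE'.
- exact: subE'.
- by apply: subset_trans (cl_U c); apply: subD1set.
- by [].
- move=> u uA; rewrite !inE (cl_AU c) ?sub1 // andbT.
  by apply: contraNneq aA' => <-.
- by apply: stacked_kept keepA _; case/andP: (cl_stacked c).
- move=> u; rewrite !inE => /andP[ua uU] uNA'.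
  have uA : u \notin a :: A' by rewrite inE negb_or ua.
  by apply: leq_trans (cl_deg c uU uA) _; apply: deg'.
- apply/subsetP=> w /(subsetP W'W) wW; rewrite !inE (subsetP (cl_WU c)) // andbT.
  apply: contraTneq (cl_AH c (mem_head a A')) => <-.
  by rewrite (disjointFr (cl_WH c) wW).
- exact: disjointWl W'W (cl_WH c).
- move=> p w pA wW'; apply: keepW => //; apply: (cl_adj c); first exact: sub1.
  exact: (subsetP W'W).
- by move=> u /sub1; apply: (cl_AH c).
- exact: cl_HU1 c.
- move=> h hH /setD1P[ha hU]; have := cl_HU c hH hU.
  by rewrite inE (negPf ha).
- lia.
- by rewrite /d in cA; lia.
- lia.
- move=> h hH; have := cl_miss c hH; rewrite /=.
  have := subset_leq_card (setSD (nbr E1 h) W'W); lia.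
- move=> u /setD1P[ua uU]; have := cl_new c uU; have := new' u (nbr E1 u) uU ua.
  by rewrite /=; lia.
Qed.

Lemma cluster_clique E U A H W : A != [::] -> cluster E U A H W -> has_clique.
Proof.
(* Removing a vertex shrinks [U]; growing the cluster enlarges [H]. *)
have [n] := ubnP (#|U| + (t - #|H|)); elim: n E U A H W => // n IH E U [//|a A'] H W.
rewrite ltnS => le_n _ c; have [/(cluster_full c)//|Ht] := leqP t #|H|.
set A := a :: A' in c; set D := nbr E a :\: [set x in A].
have sE := cl_simple c; have cA := cl_card c; rewrite /= in cA.
have aU : a \in U by apply: (cl_AU c); rewrite mem_head.
have ENA u w : [set u; w] \in E -> u \in U /\ w \in U.
  by move=> /(cl_sub c); rewrite subUset !sub1set => /andP[].
have DU : D \subset U :\: [set x in A].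
  apply/subsetP=> u /setDP[uN uA]; rewrite in_setD uA /=.
  by move: uN; rewrite inE => /ENA[].
have DA u : u \in D -> u \notin A by case/setDP=> _; rewrite inE.
have DE : D \subset nbr E a by apply: subsetDl.
have WA w : w \in W -> w \notin A.
  by move=> wW; apply/negP=> /(cl_AH c); rewrite (disjointFr (cl_WH c) wW).
have WD : W \subset D.
  apply/subsetP=> w wW; rewrite in_setD [w \in [set _ in _]]inE WA //= inE.
  by apply: (cl_adj c) => //; rewrite mem_head.
(* Of the [11 * t] in [d], the term [3 * #|H|] uses less than [3 * t], leaving the [8 * t] needed by
   [split_blocks]. *)
have Wt : 8 * t <= #|W| by lia.
have tD : 8 * t <= #|D| by apply: leq_trans Wt (subset_leq_card WD).
have cliqueE (B : {set V}) : B \subset D -> #|B| = t ->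
    immersed B E (pairs B) -> has_clique.
  move=> BD Bt immB; exists B; split=> //; apply: immersed_trans immB.
  by apply: immersedS (cl_immersed c) => //; apply: subset_trans DU.
have grow (R W' : {set V}) : R \subset D -> R != set0 -> #|R| <= t -> W' \subset W ->
    [disjoint W' & R] -> #|W| <= #|W'| + 2 * #|R| ->
    {in R & W', forall r w, ~~ non_edge E r w} -> has_clique.
  move=> RD R0 Rt W'W dW cW' RW'.
  have c' := @cluster_grow E U a A' H W W' R c Ht RD Rt W'W dW cW'.
  have {}RW' : {in R & W', forall r w, [set r; w] \in E}.
    move=> r w rR wW'; have := RW' _ _ rR wW'; rewrite negb_and !negbK.
    by case/orP=> // /eqP rw; move: rR; rewrite rw (disjointFr dW).
  apply: IH (c' RW'); last by rewrite -size_eq0 size_cat /= addnS.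
  have : H :&: R = set0.
    apply/setP=> r; rewrite !inE; apply/negP=> /andP[rH /(subsetP RD) rD].
    have /setDP[rU _] := subsetP DU _ rD.
    by have := DA _ rD; rewrite (cl_HU c rH rU).
  rewrite cardsU => ->; rewrite cards0; move: R0 le_n Ht; rewrite -card_gt0; clear; lia.
have [m [S [P [mm SD pP sP cP]]]] := tutte_berge (@non_edge_sym _ E) D.
have [miss2|miss1] := ltnP 1 #|missed D m|.
  have [||X [XD dX cX]] := @split_blocks _ _ t #|S| _ _ t_gt0 pP sP.
  - by lia.
  - by have := subset_leq_card SD; rewrite cardsDS //; lia.
  have XsD : X \subset D by apply: subset_trans XD (subsetDl _ _).
  case: cX => [[X1 X2]|/andP[X1 X2]].
    have [|| B [BX Bt immB]] := @biclique_immersed _ E X (D :\: S :\: X) t _ _ X1 X2.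
    - by rewrite disjoint_sym -setI_eq0 setIDAC setDIl setDv setI0.
    - move=> x y xX yY; have := dX _ _ xX yY.
      rewrite negb_and !negbK => /orP[/eqP xy|//].
      by case/setDP: yY; rewrite -xy xX.
    by apply: cliqueE Bt immB; apply: subset_trans XsD.
  (* [W] loses at most [#|S| + #|X|], less than [2 * #|X|]. *)
  apply: (grow X (W :\: (S :|: X))) => //.
  - by rewrite -card_gt0; apply: leq_ltn_trans X1.
  - exact: ltnW.
  - exact: subsetDl.
  - rewrite -setI_eq0; apply/eqP/setP=> u; rewrite !inE negb_or.
    by case: (u \in X); rewrite ?andbF.
  - have := cardsD_lb W (S :|: X); have [+ _] := leq_card_setU S X.
    by move: X1; clear; lia.
  - move=> r w rX; rewrite !inE negb_or => /andP[/andP[wS wX] wW].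
    by apply: dX => //; rewrite in_setD wX in_setD wS (subsetP WD).
(* The last cluster vertex is split off, and the missed vertex becomes the exceptional one; if none
   is missed, any vertex of [W] will do. *)
have [A0|A0] := eqVneq A' [::].
  have [v vD vm] : exists2 v, v \in D & {in missed D m, forall u, u = v}.
    have [m0|[v vm]] := set_0Vmem (missed D m).
      have /set0Pn[w wW] : W != set0 by rewrite -card_gt0; lia.
      by exists w; [apply: (subsetP WD)|move=> u; rewrite m0 inE].
    exists v; first by move: vm; rewrite inE => /andP[].
    move=> u um; apply/eqP; apply: contraTT miss1 => uv.
    rewrite -ltnNge -(_ : #|[set u; v]| = 2); last by rewrite cards2 uv.
    by apply: subset_leq_card; rewrite subUset !sub1set um vm.
  have va : v != a by apply: contraNneq (DA _ vD) => ->; rewrite mem_head.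
  have [vU _] := setDP (subsetP DU _ vD).
  have NA u : (u \notin A) = (u != a) by rewrite /A A0 inE.
  apply: (outer (U := U :\ a) (E := split_off E D a m) (v := v)).
  - by apply: proper_sub_trans (cl_U c); apply: properD1.
  - apply: (@immersed_trans _ _ _ E).
      apply: immersedS (cl_immersed c) => //; apply/subsetP=> u.
      by rewrite in_setD1 !inE -[_ || _]/(u \in A) NA.
    by apply: split_off_immersed => //; rewrite !inE eqxx.
  - split.
    + exact: split_off_simple.
    + by apply: split_off_sub (cl_sub c) aU.
    + by rewrite in_setD1 va.
    + have := split_off_deg_missed sE DE mm va.
      have := cl_deg c vU (DA _ vD); clear; lia.
    + move=> u /setD1P[ua uU] uv; rewrite -NA in ua.
      apply: leq_trans (cl_deg c uU ua) _; rewrite NA in ua.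
      apply: split_off_deg => // uNa; apply: contra uv => mu; apply/eqP/vm.
      by rewrite in_set mu andbT in_setD uNa andbT inE NA.
have notA u : u \notin A -> (u != a) && (u \notin A') by rewrite inE negb_or.
have /andP[aA' _] := cl_uniq c.
have A'a p : p \in A' -> p != a by apply: contraTneq => ->.
have Wa w : w \in W -> w != a by move=> /WA/notA/andP[].
have kept (F : {set {set V}}) u w : u != a -> w != a ->
    [set u; w] \in F -> [set u; w] \in split_off F D a m.
  by move=> ua wa uw; rewrite in_setU !inE uw negb_or !(eq_sym a) ua wa.
have rec E' W' : cluster E' (U :\ a) A' H W' -> has_clique.
  by apply: IH => //; move: le_n; rewrite (cardsD1 a U) aU.
have [m0|[x xm]] := set_0Vmem (missed D m).
  apply: (rec (split_off E D a m) W); apply: (cluster_remove c Ht) => //.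
  - by move=> Z aZ _; apply: split_off_immersed.
  - exact: split_off_simple.
  - by apply: split_off_sub (cl_sub c) aU.
  - move=> u uU uA; have /andP[ua _] := notA _ uA; apply: split_off_deg => // uNa.
    apply/negP=> mu; have : u \in missed D m; last by rewrite m0 inE.
    by rewrite in_set mu andbT in_setD uNa inE uA.
  - move=> u X uU ua; apply: leq_trans (split_off_new sE DE mm X ua) _.
    by rewrite addn2.
  - by move=> p w /A'a pa /Wa wa; apply: kept.
  - by move=> p w /A'a pa /A'a wa; apply: kept.
have xD : x \in D by case/setIdP: xm.
have mx : m x = x by case/setIdP: xm => _ /eqP.
have [xU _] := setDP (subsetP DU _ xD).
have xA := DA _ xD; have /andP[xa xA'] := notA _ xA.
have onlyx u : u \in missed D m -> u = x.
  move=> um; apply/eqP; apply: contraTT miss1 => uv.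
  rewrite -ltnNge -(_ : #|[set u; x]| = 2); last by rewrite cards2 uv.
  by apply: subset_leq_card; rewrite subUset !sub1set um xm.
have [p pA' ap] : exists2 p, p \in A' & [set a; p] \in E.
  by have /andP[] := cl_stacked c; rewrite (negPf A0) => /hasP.
have pA : p \in A by rewrite inE pA' orbT.
have [/exists_inP[y]|/exists_inPn noy] :=
  boolP [exists y in nbr E p :\: [set x in A], non_edge E x y]; last first.
  (* [W] lies in [nbr E p] and avoids [A], so without a suitable [y] the vertex [x] is complete to
     [W :\ x]. *)
  apply: (grow [set x] (W :\ x)).
  - by rewrite sub1set.
  - by apply/set0Pn; exists x; rewrite inE.
  - by rewrite cards1.
  - exact: subD1set.
  - by rewrite disjoint_sym disjoints1 !inE eqxx.
  - by rewrite cards1 (cardsD1 x W) addnC leq_add2l; case: (x \in W).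
  - move=> _ w /set1P-> /setD1P[wx wW]; apply: noy.
    rewrite in_setD inE WA //= inE; exact: (cl_adj c).
case/setDP=> yN yNA xy; have py : [set p; y] \in E by rewrite inE in yN.
have yA : y \notin A by rewrite inE in yNA.
have /andP[ya yA'] := notA _ yA; have [_ yU] := ENA _ _ py.
have xaE : [set x; a] \in E by move: xD; rewrite in_setD !inE setUC => /andP[].
set F := detour E a p x y.
have sF : simple F by apply: detour_simple.
have DF : nbr F a :\: [set x in A] = D :\ x.
  by apply: nbr_detour_centre => //; rewrite inE.
have DxF : D :\ x \subset nbr F a by rewrite -DF subsetDl.
(* The only edge new in [F] contains [x], which [m] leaves unmatched. *)
have mF : matching (non_edge F) (D :\ x) m.
  have [mK mD mr] := matchingP _ _ _ mm.
  have nx u : m u != u -> u != x by apply: contraNneq => ->; rewrite mx.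
  apply/matchingP; split=> // u mu; first by rewrite in_setD1 nx ?mD.
  have /andP[h1 h2] := mr _ mu; rewrite /non_edge h1.
  rewrite in_setU1 eqset2 in_setD (negPf h2) andbF orbF.
  have mux : m u != x by apply: nx; rewrite (can_eq mK).
  by rewrite (negPf (nx _ mu)) (negPf mux) andbF.
have keptF u w : u \in A' -> w != a -> w \in A' \/ w != y -> [set u; w] \in E ->
    [set u; w] \in split_off F (D :\ x) a m.
  move=> uA' wa wy uw; have ua := A'a _ uA'.
  have ux : u != x by apply: contraNneq xA' => <-.
  have uy : u != y by apply: contraNneq yA' => <-.
  have {}wy : w != y by case: wy => // wA'; apply: contraNneq yA' => <-.
  rewrite in_setU; apply/orP; left; rewrite inE; apply/andP; split.
    by apply: detour_kept => //; rewrite eqset2 ?(negPf ux) ?(negPf ua)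
      ?(negPf wa) ?(negPf wy) ?(negPf uy) ?andbF.
  by rewrite in_set2 negb_or !(eq_sym a) ua wa.
(* The detour uses up the edge from [p] to [y], so [y] must leave [W]. *)
apply: (rec (split_off F (D :\ x) a m) (W :\ y)); apply: (cluster_remove c Ht).
- move=> Z aZ dZ; apply: (@immersed_trans _ _ _ F).
    apply: detour_immersed => //.
    by rewrite (disjointFl dZ) // inE.
  exact: split_off_immersed.
- exact: split_off_simple.
- apply: split_off_sub aU => // e /setU1P[->|/setDP[/(cl_sub c)//]].
  by rewrite subUset !sub1set xU.
- move=> u uU uA; have /andP[ua uA'] := notA _ uA.
  have up : u != p by apply: contraNneq uA => ->.
  apply: leq_trans (_ : #|nbr F u| <= _); first exact: detour_deg.
  apply: split_off_deg => // uNa; apply/negP=> mu.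
  have : u \in D :\ x by rewrite -DF in_setD uNa inE uA.
  by case/setD1P=> ux uD; case/negP: ux; apply/eqP/onlyx; rewrite in_set uD.
- move=> u X uU ua; apply: leq_trans (split_off_new sF DxF mF X ua) _.
  by rewrite addn2 ltnS; apply: detour_new.
- exact: subD1set.
- by rewrite (cardsD1 y W); apply: leq_add (leq_b1 _) (leqnn _).
- by move=> q w qA' /setD1P[wy wW]; apply: keptF => //; [apply: Wa|right].
- by move=> q w qA' wA'; apply: keptF => //; [apply: A'a|left].
Qed.

End Cluster.

(** A cluster is started at the exceptional vertex [v] alone, with [W] its neighbourhood; [cl_card]
    then reads [d + 3 <= #|nbr E v| + 3]. *)
Lemma almost_regular_clique (V : finType) (E0 E : {set {set V}}) (U : {set V}) t v :
  0 < t -> immersed U E0 E -> almost_regular t U E v -> has_clique E0 t.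
Proof.
move=> t0; have [n] := ubnP #|U|.
elim: n U E v => // n IH U E v le_n imm [sE subE vU dv dU].
have outer (U' : {set V}) E' v' : U' \proper U ->
    immersed U' E0 E' -> almost_regular t U' E' v' -> has_clique E0 t.
  by move=> /proper_card lt; apply: IH; apply: leq_trans lt _.
apply: (cluster_clique t0 imm outer (E := E) (U := U) (A := [:: v])
  (H := [set v]) (W := nbr E v)) => //.
have vv u : u \in nbr E v -> u != v by rewrite inE => /(simple_neq sE); rewrite eq_sym.
split; rewrite ?cards1 //=.
- by apply: immersedS imm => //; apply: subsetDl.
- by move=> u /[!inE]/eqP->.
- by move=> u uU /[!inE]; apply: dU.
- by apply/subsetP=> u /[!inE]/subE; rewrite subUset !sub1set => /andP[].
- by rewrite disjoint_sym disjoints1; apply/negP=> /vv; rewrite eqxx.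
- by move=> u w /[!inE]/eqP->.
- by move=> u /[!inE].
- by rewrite sub1set.
- by move=> u /[!inE].
- by move: dv; clear; lia.
- by move: dv; clear; lia.
- by move=> u /[!inE]/eqP->; rewrite setDv cards0.
- by move=> u _; rewrite setDv cards0.
Qed.

Lemma mem_edges (G : sgraph) (x y : G) : ([set x; y] \in edges G) = adj x y.
Proof.
apply/imsetP/idP => [[[u w] /= uw /eqP]|xy]; last by exists (x, y); rewrite ?inE.
by rewrite inE in uw; rewrite eqset2 => /orP[]/andP[/eqP-> /eqP->]; rewrite // adj_sym.
Qed.

Theorem theorem3 (t : nat) (t_gt0 : 0 < t) (G : sgraph) :
  11 * t + 7 <= min_degree G ->
  contains_strong_immersion G (complete_graph t_gt0).
Proof.
move=> dG; have /card_gt0P[v _] := vertex_nonempty G.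
have degE x : #|nbr (edges G) x| = degree x.
  by apply: eq_card => y; rewrite !inE mem_edges.
have big x : 11 * t + 6 < #|nbr (edges G) x|.
  by rewrite degE; apply: leq_trans (min_degree_le x); rewrite -addnS.
have [||B [Bt immB]] := @almost_regular_clique _ (edges G) (edges G) setT t v t_gt0.
- exact: immersed_refl.
- split=> //; last exact: ltnW.
  move=> e /imsetP[[x y] /[!inE] /= xy ->]; rewrite cards2.
  by case: eqVneq xy => // ->; rewrite adj_irrefl.
exact: immersed_pairs_strong Bt immB.
Qed.
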